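(* Let $q$ be an odd prime power, $n>1$, and $\ell(x)=ax^{q^m}+bx^{q^l}$ with $a,b\in\mathbb F_{q^n}^*$ and integers $0<l<m<\frac n2$. Let $d=\gcd(m,m-l)$, $e=\operatorname{lcm}(m+l,m-l)$, and $L=\frac{\ell+\ell'}2$. Then: (1) $\alpha\ell(x)^{q^{n-m-l}}=\ell'(x)$ for some $\alpha\in\mathbb F_{q^n}^*$ if and only if $a^{q^l+1}=b^{q^m+1}$; (2) if both $m+l$ and $m-l$ divide $n$, and $a=\gamma^{q^m+1}\delta$, $b=-\gamma^{q^l+1}\delta$ for some $\gamma\in\mathbb F_{q^n}^*$ and $\delta\in\mathbb F_{q^{m-l}}^*$ such that either (i) $v_2(l)\ge v_2(m-l)$ and $\gcd\big(\frac ne,q\big)\neq1$, or (ii) $v_2(l)<v_2(m-l)$, $\delta^{\frac{q^{m-l}-1}{q^d+1}\gcd(\frac ne,q^d+1)}=1$, and either $\delta^{\frac{q^{m-l}-1}{q^d+1}}\neq1$ or $\gcd\big(\frac ne,q\big)\neq1$, then $\dim_{\mathbb F_q}\ker L=2m$; (3) conversely, if $a^{q^l+1}=b^{q^m+1}$ and $\dim_{\mathbb F_q}\ker L=2m$, then both $m+l$ and $m-l$ divide $n$, and $a=\gamma^{q^m+1}\delta$, $b=-\gamma^{q^l+1}\delta$ for some $\gamma\in\mathbb F_{q^n}^*$ and $\delta\in\mathbb F_{q^{m-l}}^*$ satisfying (i) or (ii) above.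
   Context: For $\ell(x)=\sum_{i=0}^{n-1}c_ix^{q^i}$ with $c_i\in\mathbb F_{q^n}$, define $\ell'(x)=c_0x+\sum_{i=1}^{n-1}(c_ix)^{q^{n-i}}$; polynomial identities such as $\alpha\ell(x)^{q^{n-m-l}}=\ell'(x)$ are as polynomials. $L$ is viewed as an $\mathbb F_q$-linear endomorphism of $\mathbb F_{q^n}$. $v_2$ denotes the $2$-adic valuation on $\mathbb Q$. *)

(* Defs.v *)
From HB Require Import structures.
From mathcomp Require Import all_boot all_order all_algebra all_fingroup all_field.

Set Implicit Arguments.
Unset Strict Implicit.
Unset Printing Implicit Defensive.

Import GRing.Theory.
Local Open Scope ring_scope.

(* The base field is F = F_q and E = F_{q^n}, i.e. \dim {:E} = n over F.      *)

(* The coefficient c_i of x^{q^i} in a q-polynomial p is p`_(q ^ i).          *)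
Definition qadjoint (E : fieldType) (q n : nat) (p : {poly E}) : {poly E} :=
  p`_1 *: 'X + \sum_(1 <= i < n) (p`_(q ^ i) *: 'X) ^+ (q ^ (n - i))%N.

Definition qbinomial (E : fieldType) (q m l : nat) (a b : E) : {poly E} :=
  a *: 'X^(q ^ m)%N + b *: 'X^(q ^ l)%N.

Definition qsympart (E : fieldType) (q n : nat) (p : {poly E}) : {poly E} :=
  2%:R^-1 *: (p + qadjoint q n p).

(* linfun f is a junk value when f is not linear; qsympart_endE below shows   *)
(* that this does not happen for the polynomials used here.                   *)
Definition poly_end (F : fieldType) (E : fieldExtType F) (p : {poly E}) :
  'End(E) := linfun (fun x : E => p.[x]).

(* x lies in the degree k subextension of E / F, i.e. in F_{q^k}; E has such  *)
(* a subfield only if k divides n, and it is then unique.                     *)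
Definition in_GF (F : fieldType) (E : fieldExtType F) (k : nat) (x : E) :
  Prop := exists2 K : {subfield E}, \dim K = k & x \in K.

Definition cond_i (q n m l : nat) : Prop :=
  let e := lcmn (m + l) (m - l) in
  (logn 2 (m - l) <= logn 2 l)%N /\ gcdn (n %/ e) q <> 1%N.

(* When logn 2 l < logn 2 (m - l), 2d divides m - l, hence q ^ d + 1 divides  *)
(* q ^ (m - l) - 1 and the truncated quotients below are exact.               *)
Definition cond_ii (E : fieldType) (q n m l : nat) (delta : E) : Prop :=
  let d := gcdn m (m - l) in
  let e := lcmn (m + l) (m - l) in
  let N := ((q ^ (m - l) - 1) %/ (q ^ d + 1))%N in
  [/\ (logn 2 l < logn 2 (m - l))%N,
      delta ^+ (N * gcdn (n %/ e) (q ^ d + 1))%N = 1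
    & delta ^+ N <> 1 \/ gcdn (n %/ e) q <> 1%N].

Section Linearity.

Variables (F : finFieldType) (E : fieldExtType F).
Local Notation q := #|F|.

Lemma card_pow_linear i (k : F) (x y : E) :
  (k *: x + y) ^+ (q ^ i)%N = k *: x ^+ (q ^ i)%N + y ^+ (q ^ i)%N.
Proof.
have [p pr_p pcharFp] := finPcharP F.
have pcharEp : p \in [pchar E] by rewrite pchar_lalg.
have q_nat : ([pchar E]).-nat (q ^ i)%N.
  rewrite pnatX; apply/orP; left.
  rewrite (card_pprimeChar pcharFp) pnatX pnatE //.
  by rewrite pcharEp.
rewrite exprDn_pchar // exprZn; congr (_ *: _ + _).
elim: i {q_nat} => [|i IHi]; first by rewrite expn0 expr1.
by rewrite expnSr exprM IHi expf_card.
Qed.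

Lemma qbinomial_linear m l (a b : E) :
  linear (fun x : E => (qbinomial q m l a b).[x]).
Proof.
move=> k x y; rewrite /qbinomial !hornerD !hornerZ !hornerXn !card_pow_linear.
by rewrite !mulrDr -!scalerAr scalerDr addrACA.
Qed.

Lemma qadjoint_linear n (p : {poly E}) :
  linear (fun x : E => (qadjoint q n p).[x]).
Proof.
move=> k x y; rewrite /qadjoint !hornerD !hornerZ !hornerX !horner_sum.
rewrite mulrDr -scalerAr scalerDr addrACA; congr (_ + _).
rewrite scaler_sumr -big_split /=; apply: eq_bigr => i _.
by rewrite !hornerE mulrDr -scalerAr card_pow_linear.
Qed.

Lemma qsympart_endE n m l (a b x : E) :
  poly_end (qsympart q n (qbinomial q m l a b)) x
  = (qsympart q n (qbinomial q m l a b)).[x].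
Proof.
set p := qsympart _ _ _.
have lin_p : linear (fun x : E => p.[x]).
  move: (@qbinomial_linear m l a b) (@qadjoint_linear n (qbinomial q m l a b)).
  rewrite {}/p /qsympart; move: (qbinomial q m l a b) => s; move: (qadjoint q n s).
  move=> r lin_s lin_r k y z; rewrite !hornerZ !hornerD lin_s lin_r.
  by rewrite addrACA -scalerDr mulrDr -scalerAr.
pose lM := GRing.isLinear.Build F E E *:%R (fun x : E => p.[x]) lin_p.
pose fL : {linear E -> E} := HB.pack (fun x : E => p.[x]) lM.
exact: (lfunE fL).
Qed.

End Linearity.

(* Main.v *)
Require Import Defs.
From HB Require Import structures.
From mathcomp Require Import all_boot all_order all_algebra all_fingroup all_field.
From mathcomp Require Import cyclic ring.

Import GRing.Theory.
Local Open Scope ring_scope.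

(* Write S for the q-Frobenius, r = m - l, s = m + l, e = lcm(r, s), f = n / e.
   When a^(q^l+1) = b^(q^m+1), applying S^s to 2L factors it as
   (S^s + beta) o (a S^r + b) o S^l with beta = b^(q^m) / a. The two factors have
   kernels of dimension at most s and r, so dim ker L = 2m iff both kernels are
   full and ker (S^s + beta) lies in the image of a S^r + b. A kernel
   {y | S^k y = c y} is full iff k | n and it is nonzero; for k = r this produces
   gamma and delta. After rescaling by gamma, the remaining condition is that
   S^s v = x v, x = delta^(q^m-1), has a nonzero solution and that
   v / delta is in the image of S^r - 1 for every solution v. Any solution has
   S^e v = C v, where C is the norm of x from F_(q^e) to F_(q^s). By
   Hilbert 90 a nonzero solution exists iff C^f = 1, and the image condition
   says that the trace of v / delta to F_(q^e), namely
   (1 + C + ... + C^(f-1)) v / delta, vanishes: thus C <> 1, or f = 0 in F.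
   Finally C = 1 if gcd(s, r) divides m, which is the case v_2(l) >= v_2(m-l);
   otherwise gcd(s, r) = 2d and C = delta^((q^r-1)/(q^d+1)). *)

(** * Frobenius powers S^k on E, twisted differences S^k - c, traces, and both forms of Hilbert
    90 *)

Section Frobenius.

Set Implicit Arguments.
Unset Strict Implicit.
Unset Printing Implicit Defensive.

Variables (F : finFieldType) (E : fieldExtType F).
Local Notation q := #|F|.
Local Notation n := (\dim {:E}).
Implicit Types (x y c u v w : E) (i j k : nat).

Lemma card_field_gt1 : (1 < q)%N.
Proof. exact: finNzRing_gt1. Qed.
Local Notation q_gt1 := card_field_gt1.

Lemma pow_linfunE k x :
  linfun (fun y : E => y ^+ (q ^ k)%N) x = x ^+ (q ^ k)%N.
Proof.
pose f (y : E) := y ^+ (q ^ k)%N.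
have lin_f : linear f by move=> u y z; exact: card_pow_linear.
pose lM := GRing.isLinear.Build F E E *:%R f lin_f.
pose fL : {linear E -> E} := HB.pack f lM.
exact: (lfunE fL).
Qed.

Fact frob_is_ahom k : ahom_in {:E} (linfun (fun y : E => y ^+ (q ^ k)%N)).
Proof.
by apply/ahom_inP; split=> [x y _ _|]; rewrite !pow_linfunE ?exprMn ?expr1n.
Qed.

(* Locked so that simplification does not unfold [ahval (frob k)]. *)
Definition frob k : 'AEnd(E) := locked (AHom (frob_is_ahom k)).

Lemma frobE k x : frob k x = x ^+ (q ^ k)%N.
Proof. by rewrite /frob -lock; apply: pow_linfunE. Qed.

Lemma frobM k x y : frob k (x * y) = frob k x * frob k y.
Proof. exact: rmorphM. Qed.

Lemma frobV k x : frob k x^-1 = (frob k x)^-1.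
Proof. by rewrite !frobE exprVn. Qed.

Lemma frobX k i x : frob k (x ^+ i) = frob k x ^+ i.
Proof. exact: rmorphXn. Qed.

Lemma frob_frob i j x : frob i (frob j x) = frob (i + j) x.
Proof. by rewrite !frobE -exprM -expnD addnC. Qed.

Lemma frob0 x : frob 0 x = x.
Proof. by rewrite frobE expr1. Qed.

Lemma frob_eq0 k x : (frob k x == 0) = (x == 0).
Proof. by rewrite fmorph_eq0. Qed.

Lemma lker_frob k : lker (frob k) = 0%VS.
Proof. exact/eqP/lker0P/fmorph_inj. Qed.

Lemma frob_dim x : frob n x = x.
Proof.
have := card_vspacef (Vector.class (finvect_type E)).
rewrite card_vspace frobE => ->.
exact: (@expf_card (finvect_type E) x).
Qed.

Lemma frob_addn k x : frob (n + k) x = frob k x.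
Proof. by rewrite addnC -frob_frob frob_dim. Qed.

Lemma frob_fix_mul i k x : frob i x = x -> frob (i * k) x = x.
Proof.
move=> fx; elim: k => [|k IHk]; first by rewrite muln0 frob0.
by rewrite mulnS -frob_frob IHk.
Qed.

Lemma frob_fix_mod i k x : frob i x = x -> frob (k %% i) x = frob k x.
Proof.
move=> fx; rewrite {2}(divn_eq k i) addnC -frob_frob mulnC.
by rewrite frob_fix_mul.
Qed.

(** [V] has [q ^ \dim V] elements, and a nonzero polynomial has fewer roots than its size. *)
Lemma dim_roots (V : {vspace E}) (P : {poly E}) k :
  P != 0 -> (size P <= (q ^ k).+1)%N -> {in V, forall x, root P x} ->
  (\dim V <= k)%N.
Proof.
move=> nzP szP rootsV; pose T := finvect_type E.
have := card_vspace (V : {vspace T}); rewrite cardE => cV.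
rewrite -(leq_exp2l _ _ q_gt1) -cV -ltnS; apply: leq_trans szP.
apply: (@max_poly_roots E) => //; last exact: enum_uniq.
apply/allP=> x Vx; apply: rootsV.
by rewrite -(@mem_enum T (mem (V : {vspace T}))).
Qed.

Definition tdiff k c : 'End(E) := (frob k : 'End(E)) - amull c.

Lemma tdiffE k c x : tdiff k c x = frob k x - c * x.
Proof. by rewrite /tdiff add_lfunE opp_lfunE lfunE. Qed.

Lemma mem_ker_tdiff k c x : (x \in lker (tdiff k c)) = (frob k x == c * x).
Proof. by rewrite memv_ker tdiffE subr_eq0. Qed.

Lemma dim_ker_tdiff_le k c : (0 < k)%N -> (\dim (lker (tdiff k c)) <= k)%N.
Proof.
move=> k_gt0; pose P : {poly E} := 'X^(q ^ k) - c *: 'X.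
have qk_gt1 : (1 < q ^ k)%N by rewrite -(expn0 q) ltn_exp2l ?q_gt1.
have szP : size P = (q ^ k).+1.
  rewrite size_polyDl size_polyXn // size_polyN ltnS.
  by apply: leq_trans (size_scale_leq _ _) _; rewrite size_polyX.
apply: (@dim_roots _ P); rewrite ?szP //; first by rewrite -size_poly_gt0 szP.
move=> x; rewrite mem_ker_tdiff frobE rootE !hornerE => /eqP ->.
by rewrite subrr.
Qed.

Definition fixf k : {subfield E} := [aspace of fixedSpace (frob k)].

Lemma mem_fixf k x : (x \in fixf k) = (frob k x == x).
Proof. by apply/fixedSpaceP/eqP. Qed.

Lemma lker_tdiff1 k : lker (tdiff k 1) = fixf k.
Proof. by apply/vspaceP=> x; rewrite mem_ker_tdiff mul1r mem_fixf. Qed.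

(** When k N = n this is the trace from E to F_(q^k). *)
Definition frob_trace k N : 'End(E) := \sum_(i < N) (frob (k * i) : 'End(E)).

Lemma frob_traceE k N x : frob_trace k N x = \sum_(i < N) frob (k * i) x.
Proof. by rewrite sum_lfunE. Qed.

Lemma tdiff_trace k N x : tdiff k 1 (frob_trace k N x) = tdiff (k * N) 1 x.
Proof.
rewrite !tdiffE frob_traceE !mul1r raddf_sum -sumrB /=.
under eq_bigr => i _ do rewrite frob_frob -mulnS.
rewrite -(big_mkord xpredT (fun i => frob (k * i.+1) x - frob (k * i) x)).
by rewrite telescope_sumr // muln0 frob0.
Qed.

Lemma trace_tdiff k N x : frob_trace k N (tdiff k 1 x) = tdiff (k * N) 1 x.
Proof.
rewrite -tdiff_trace !tdiffE !frob_traceE !mul1r raddf_sum -sumrB.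
by apply: eq_bigr => i _; rewrite rmorphB /= !frob_frob addnC.
Qed.

Lemma tdiff_dim x : tdiff n 1 x = 0.
Proof. by rewrite tdiffE frob_dim mul1r subrr. Qed.

(** The trace is given by a polynomial of degree q^(k(N-1)). *)
Lemma dim_trace_zeros_le k N (V : {vspace E}) : (0 < N)%N -> (0 < k)%N ->
  {in V, forall x, frob_trace k N x = 0} -> (\dim V <= k * N.-1)%N.
Proof.
case: N => // N _ k_gt0 trV.
pose P : {poly E} := \sum_(i < N.+1) 'X^(q ^ (k * i)).
have szP : size P = (q ^ (k * N)).+1.
  rewrite /P big_ord_recr /= addrC size_polyDl size_polyXn //.
  apply: (leq_ltn_trans (size_sum _ _ _)).
  rewrite ltnS; apply/bigmax_leqP => i _; rewrite size_polyXn.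
  by rewrite ltn_exp2l ?q_gt1 // ltn_pmul2l.
apply: (@dim_roots _ P); rewrite ?szP //; first by rewrite -size_poly_gt0 szP.
move=> x /trV; rewrite frob_traceE rootE /P horner_sum => eq0.
by apply/eqP; rewrite -[RHS]eq0; apply: eq_bigr => i _; rewrite hornerXn frobE.
Qed.

Lemma dim_ext_gt0 : (0 < n)%N.
Proof. exact: adim_gt0. Qed.

Lemma dvdn_dim_gt0 k : (k %| n)%N -> (0 < k)%N /\ (0 < n %/ k)%N.
Proof.
move=> kn; have n0 := dim_ext_gt0; have k0 := dvdn_gt0 n0 kn.
by split=> //; rewrite divn_gt0 // dvdn_leq.
Qed.

(** Additive Hilbert 90 by counting: the image of S^k - 1 lies in the kernel of the trace, the
    kernels of S^k - 1 and of the trace have dimension at most k and n - k, and rank-nullity turns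
    all these bounds into equalities. *)
Lemma dim_fixf_limg k : (k %| n)%N ->
  \dim (fixf k) = k /\ limg (tdiff k 1) = lker (frob_trace k (n %/ k)).
Proof.
move=> kn; have [k_gt0 nk_gt0] := dvdn_dim_gt0 kn.
have nE : (k * (n %/ k))%N = n by rewrite mulnC divnK.
have sub : (limg (tdiff k 1) <= lker (frob_trace k (n %/ k)))%VS.
  apply/subvP=> _ /memv_imgP[x _ ->].
  by rewrite memv_ker trace_tdiff nE tdiff_dim.
have dimD := limg_ker_dim (tdiff k 1) fullv.
rewrite capfv lker_tdiff1 in dimD.
have leF : (\dim (fixf k) <= k)%N by rewrite -lker_tdiff1 dim_ker_tdiff_le.
have leT : (\dim (lker (frob_trace k (n %/ k))) <= k * (n %/ k).-1)%N.
  by apply: dim_trace_zeros_le => // x; rewrite memv_ker => /eqP.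
have kE : (k + k * (n %/ k).-1)%N = n by rewrite -mulnS prednK.
have leS := dimvS sub.
have eqF : \dim (fixf k) = k.
  apply/eqP; rewrite eqn_leq leF /= -(leq_add2r (k * (n %/ k).-1)) kE.
  rewrite -[X in (X <= _)%N]dimD.
  by rewrite leq_add2l (leq_trans leS).
split=> //; apply/eqP; rewrite eqEdim sub /=.
apply: (leq_trans leT); rewrite -(leq_add2l k) kE -[X in (X <= _)%N]dimD.
by rewrite eqF.
Qed.

Lemma dim_fixf k : (k %| n)%N -> \dim (fixf k) = k.
Proof. by case/dim_fixf_limg. Qed.

Lemma limg_tdiff1 k : (k %| n)%N ->
  limg (tdiff k 1) = lker (frob_trace k (n %/ k)).
Proof. by case/dim_fixf_limg. Qed.

Lemma limg_tdiff1_mul k N : (limg (tdiff (k * N) 1) <= limg (tdiff k 1))%VS.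
Proof.
by apply/subvP=> _ /memv_imgP[x _ ->]; rewrite -tdiff_trace memv_img ?memvf.
Qed.

Lemma amullE u x : amull u x = u * x.
Proof. by rewrite lfunE. Qed.

Lemma lker_amull u : u != 0 -> lker (amull u) = 0%VS.
Proof. by move=> nzu; apply/eqP/lker0_amull; rewrite unitfE. Qed.

Lemma dim_amull u (V : {vspace E}) : u != 0 -> \dim (amull u @: V) = \dim V.
Proof. by move=> nzu; rewrite limg_dim_eq // lker_amull ?capv0. Qed.

(** Dividing a solution of S^k y = c y by a nonzero one gives a fixed point of S^k. *)
Lemma ker_tdiff_coset k c u : u != 0 -> u \in lker (tdiff k c) ->
  lker (tdiff k c) = (amull u @: fixf k)%VS.
Proof.
move=> nzu; rewrite mem_ker_tdiff => /eqP fu.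
apply/vspaceP=> x; apply/idP/memv_imgP => [|[y]].
  rewrite mem_ker_tdiff => /eqP fx; exists (x / u); last first.
    by rewrite lfunE /= mulrC divfK.
  have nzc : c != 0.
    by apply: contraNneq nzu => c0; rewrite -(frob_eq0 k) fu c0 mul0r.
  by rewrite mem_fixf frobM frobV fx fu -mulf_div divff // mul1r.
rewrite mem_fixf => /eqP fy ->; rewrite mem_ker_tdiff lfunE /= frobM fy fu.
by rewrite mulrA.
Qed.

(** A nonzero kernel is a scaled copy of the subfield [fixf k], whose dimension divides n. *)
Lemma dim_ker_tdiff k c : (0 < k)%N ->
  \dim (lker (tdiff k c)) = k <->
  (k %| n)%N /\ exists2 u, u != 0 & u \in lker (tdiff k c).
Proof.
move=> k_gt0; split=> [dk | [kn [u nzu uK]]]; last first.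
  by rewrite (ker_tdiff_coset nzu uK) dim_amull // dim_fixf.
have nzK : lker (tdiff k c) != 0%VS by rewrite -dimv_eq0 dk -lt0n.
have nzu : vpick (lker (tdiff k c)) != 0 by rewrite vpick0.
have uK := memv_pick (lker (tdiff k c)).
split; last by exists (vpick (lker (tdiff k c))).
rewrite -[X in (X %| _)%N]dk (ker_tdiff_coset nzu uK) dim_amull //.
exact: field_dimS (subvf _).
Qed.

(** Multiplicative Hilbert 90, read off from a generator z of the group of units: if c = z^i has
    norm 1, then q^k - 1 divides i, and u = z^(i / (q^k - 1)) works. *)
Lemma Hilbert90_finite k c : (k %| n)%N ->
  c ^+ (\sum_(i < n %/ k) (q ^ k) ^ i) = 1 ->
  exists2 u, u != 0 & frob k u = c * u.
Proof.
move=> kn cN1; pose T := finvect_type E.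
have [k_gt0 nk_gt0] := dvdn_dim_gt0 kn.
have qn_gt1 : (1 < q ^ n)%N by rewrite -(expn0 q) ltn_exp2l ?q_gt1 ?dim_ext_gt0.
have qk_gt1 : (1 < q ^ k)%N by rewrite -(expn0 q) ltn_exp2l ?q_gt1.
have N_gt0 : (0 < (q ^ n).-1)%N by rewrite -ltnS prednK // ltnW.
have unity (x : E) : x != 0 -> x ^+ (q ^ n).-1 = 1.
  move=> nzx; apply: (mulfI nzx).
  rewrite -exprS prednK ?mulr1 -1?frobE ?frob_dim //.
  exact: ltnW.
have /hasP[z _ z_prim] :
    has (q ^ n).-1.-primitive_root (enum (predC1 (0 : T)) : seq E).
  apply: has_prim_root => //.
  - apply/allP=> x xin; apply/unity_rootP/unity.
    by have := xin : (x : T) \in enum (predC1 (0 : T)); rewrite mem_enum.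
  - exact: (enum_uniq (predC1 (0 : T))).
  rewrite -(cardE (predC1 (0 : T))) cardC1 -(card_vspacef (Vector.class T)).
  by rewrite card_vspace.
have nzc : c != 0.
  apply/eqP=> c0; move: cN1; rewrite c0 expr0n.
  by rewrite -(prednK nk_gt0) big_ord_recl /= => /eqP; rewrite eq_sym oner_eq0.
have [[i i_lt] /= cE] := prim_rootP z_prim (unity _ nzc).
have nzz : z != 0.
  apply: contraNneq (oner_neq0 E) => z0.
  by rewrite -(prim_expr_order z_prim) z0 expr0n eqn0Ngt N_gt0.
(* The order q^n - 1 of z is q^k - 1 times the norm exponent, which is positive and cancels. *)
have dvd_i : ((q ^ k).-1 %| i)%N.
  have := cN1; rewrite cE -exprM => /eqP; rewrite -(prim_order_dvd z_prim).
  have -> : (q ^ n = (q ^ k) ^ (n %/ k))%N by rewrite -expnM mulnC divnK.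
  rewrite predn_exp dvdn_pmul2r // -(prednK nk_gt0) big_ord_recl.
  by rewrite expn0.
exists (z ^+ (i %/ (q ^ k).-1)); first by rewrite expf_neq0.
rewrite cE; set w := z ^+ _; rewrite frobE -(ltn_predK qk_gt1) exprS mulrC.
by rewrite -exprM divnK.
Qed.

End Frobenius.

(** For x in K, [frob_dim] is applied to K itself as an extension of F; conversely [fixf E k] is the
    required subfield. *)
Lemma in_GFE (F : finFieldType) (E : fieldExtType F) (k : nat) (x : E) :
  (k %| \dim {:E})%N -> in_GF k x <-> frob E k x = x.
Proof.
move=> kn; split=> [[K <- Kx] | fx]; last first.
  by exists (fixf E k); rewrite ?dim_fixf // mem_fixf fx.
have := frob_dim (vsproj K x); rewrite frobE.
move/(congr1 vsval); rewrite rmorphXn /= vsprojK // frobE.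
by rewrite dimvf.
Qed.

(** * Dimension of the kernel of a composite *)

Section KernelOfComposite.

Set Implicit Arguments.
Unset Strict Implicit.
Unset Printing Implicit Defensive.

Variables (K : fieldType) (V : vectType K) (g h : 'End(V)).

(** Rank-nullity for h restricted to ker (g o h): its kernel is ker h and its image is the
    intersection of ker g and im h. *)
Lemma dim_lker_comp :
  \dim (lker (g \o h)) = (\dim (lker h) + \dim (lker g :&: limg h))%N.
Proof.
rewrite -(limg_ker_dim h (lker (g \o h))); congr (_ + _)%N; congr (\dim _).
  apply/capv_idPr/subvP=> x; rewrite !memv_ker comp_lfunE => /eqP ->.
  by rewrite linear0.
apply/vspaceP=> y; rewrite memv_cap; apply/memv_imgP/andP.
  case=> x; rewrite memv_ker comp_lfunE => /eqP gh0 ->.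
  by rewrite memv_ker gh0 eqxx memv_img ?memvf.
case=> gy /memv_imgP[x _ yE]; exists x => //.
by rewrite memv_ker comp_lfunE -yE -memv_ker.
Qed.

Lemma dim_lker_comp_max r s :
  (\dim (lker h) <= r)%N -> (\dim (lker g) <= s)%N ->
  \dim (lker (g \o h)) = (r + s)%N <->
  [/\ \dim (lker h) = r, \dim (lker g) = s & (lker g <= limg h)%VS].
Proof.
move=> hr gs; rewrite dim_lker_comp; split=> [dimE | [-> <- /capv_idPl -> //]].
have capl := capvSl (lker g) (limg h); have le := dimvS capl.
have le' := leq_trans le gs.
have hE : \dim (lker h) = r.
  by apply/eqP; rewrite eqn_leq hr -(leq_add2r s) -dimE leq_add2l.
have cE : \dim (lker g :&: limg h) = s.
  by apply/eqP; rewrite -(eqn_add2l r) -dimE hE.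
have gE : \dim (lker g) = s by apply/eqP; rewrite eqn_leq gs -cE.
split=> //; apply/capv_idPl/eqP; rewrite eqEdim capl gE cE.
exact: leqnn.
Qed.

End KernelOfComposite.

(** * The gcd of m + l and m - l, and its dependence on 2-adic valuations *)

Section Arithmetic.

Set Implicit Arguments.
Unset Strict Implicit.

(** Put d = gcd(l, m - l), l = d l1 and m - l = d r1. Then m + l = d (2 l1 + r1), and gcd(2 l1 + r1,
    r1) = gcd(2, r1) since l1 and r1 are coprime. The comparison of valuations becomes the parity of
    r1. *)
Lemma gcdn_sum_diff m l : (0 < l < m)%N ->
  exists2 d, (0 < d)%N & exists l1 r1 : nat,
  [/\ m = (d * (l1 + r1))%N, gcdn m (m - l) = d,
      gcdn (m + l) (m - l) = (d * gcdn 2 r1)%N,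
      coprime l1 r1 & (logn 2 (m - l) <= logn 2 l)%N = odd r1].
Proof.
case/andP=> l_gt0 lm; have r_gt0 : (0 < m - l)%N by rewrite subn_gt0.
set r := (m - l)%N in r_gt0 *; pose d := gcdn l r.
have mE : m = (l + r)%N by rewrite subnKC // ltnW.
have d_gt0 : (0 < d)%N by rewrite gcdn_gt0 l_gt0.
have lE : l = (d * (l %/ d))%N by rewrite mulnC divnK ?dvdn_gcdl.
have rE : r = (d * (r %/ d))%N by rewrite mulnC divnK ?dvdn_gcdr.
set l1 := (l %/ d)%N in lE; set r1 := (r %/ d)%N in rE.
have l1_gt0 : (0 < l1)%N by move: l_gt0; rewrite lE muln_gt0 => /andP[].
have r1_gt0 : (0 < r1)%N by move: r_gt0; rewrite rE muln_gt0 => /andP[].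
have co : coprime l1 r1.
  by rewrite /coprime -(eqn_pmul2l d_gt0) muln_gcdr -lE -rE muln1.
exists d => //; exists l1, r1; split=> //.
- by rewrite mulnDr -lE -rE.
- by rewrite mE gcdnC gcdnDr gcdnC.
- rewrite mE addnAC addnn -mul2n gcdnC gcdnDr gcdnC lE rE mulnCA -muln_gcdr.
  by rewrite gcdnC Gauss_gcdl 1?coprime_sym // gcdnC.
rewrite lE rE !lognM // leq_add2l; have [r1odd|r1even] := boolP (odd r1).
  by rewrite [logn 2 r1]logn_coprime // coprime2n.
have l1odd : odd l1.
  apply: contraLR co => l1even; rewrite /coprime; apply/eqP=> g1.
  by have := dvdn_gcd 2 l1 r1; rewrite g1 !dvdn2 l1even r1even.
rewrite [logn 2 l1]logn_coprime ?coprime2n // leqn0.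
by apply/negbTE; rewrite -lt0n logn_gt0 mem_primes r1_gt0 dvdn2.
Qed.

Lemma gcdn_sum_diff_dvd m l : (0 < l < m)%N ->
  (logn 2 (m - l) <= logn 2 l)%N -> (gcdn (m + l) (m - l) %| m)%N.
Proof.
case/gcdn_sum_diff=> d _ [l1 [r1 [mE _ -> _ ->]]] r1odd.
by rewrite [gcdn 2 _](eqP (_ : coprime 2 r1)) ?coprime2n // mE muln1 dvdn_mulr.
Qed.

(** Here r1 is even, so l1 is odd by coprimality, and m / d = l1 + r1 is odd. *)
Lemma gcdn_sum_diff_double m l : (0 < l < m)%N ->
  (logn 2 l < logn 2 (m - l))%N ->
  gcdn (m + l) (m - l) = (2 * gcdn m (m - l))%N
  /\ exists k, m = (gcdn m (m - l) * (2 * k).+1)%N.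
Proof.
case/gcdn_sum_diff=> d _ [l1 [r1 [mE -> -> co]]]; rewrite ltnNge => -> r1even.
have g2 : gcdn 2 r1 = 2 by apply/gcdn_idPl; rewrite dvdn2.
have l1odd : odd l1.
  apply: contraLR co => l1even; rewrite /coprime; apply/eqP=> g1.
  by have := dvdn_gcd 2 l1 r1; rewrite g1 !dvdn2 l1even r1even.
split; first by rewrite g2 mulnC.
exists (l1 + r1)./2; rewrite {1}mE; congr (_ * _)%N.
by rewrite -{1}[(l1 + r1)%N]odd_double_half oddD l1odd (negPf r1even) mul2n.
Qed.

Lemma expr_gcdn1 (R : fieldType) (x : R) i j :
  x ^+ i = 1 -> x ^+ j = 1 -> x ^+ gcdn i j = 1.
Proof.
have [-> _ xj | i_gt0 xi xj] := posnP i; first by rewrite gcd0n.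
have [u v uv _] := egcdnP j i_gt0.
have : x ^+ (u * i) = 1 by rewrite mulnC exprM xi expr1n.
by rewrite uv exprD mulnC exprM xj expr1n mul1r.
Qed.

End Arithmetic.

(** * Norms, and the criterion for the rescaled equation *)

Section NormTrace.

Set Implicit Arguments.
Unset Strict Implicit.
Unset Printing Implicit Defensive.

Variables (F : finFieldType) (E : fieldExtType F).
Local Notation q := #|F|.
Local Notation n := (\dim {:E}).
Local Notation frob := (frob E).
Local Notation fixf := (fixf E).
Implicit Types (x y c u v w : E) (i j k : nat).

Lemma frob_prod k (I : finType) (f : I -> E) :
  frob k (\prod_i f i) = \prod_i frob k (f i).
Proof. exact: rmorph_prod. Qed.

(** On F_(q^(kN)) this is the norm to F_(q^k). *)
Definition frob_norm k N x : E := \prod_(i < N) frob (k * i) x.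

Lemma frob_normE k N x :
  frob_norm k N x = x ^+ (\sum_(i < N) (q ^ k) ^ i)%N.
Proof. by rewrite expr_sum; apply: eq_bigr => i _; rewrite frobE expnM. Qed.

Lemma frob_norm_fix j k N x : frob j x = x ->
  frob j (frob_norm k N x) = frob_norm k N x.
Proof.
move=> fx; rewrite frob_prod; apply: eq_bigr => i _.
by rewrite frob_frob addnC -frob_frob fx.
Qed.

Lemma frob_normM k N i x : frob (k * N) x = x ->
  frob_norm k (N * i) x = frob_norm k N x ^+ i.
Proof.
move=> fx; elim: i => [|i IHi]; first by rewrite muln0 /frob_norm big_ord0.
rewrite mulnSr /frob_norm big_split_ord exprSr -[in RHS]IHi; congr (_ * _).
apply: eq_bigr => j _ /=; rewrite mulnDr addnC -frob_frob mulnA.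
by rewrite (frob_fix_mul _ fx).
Qed.

(** S^k permutes the factors cyclically; the two ways of splitting off an end factor of the product
    of N + 1 terms are compared. *)
Lemma frob_norm_shift k N x : x != 0 -> frob (k * N) x = x ->
  frob k (frob_norm k N x) = frob_norm k N x.
Proof.
move=> nzx fx; rewrite frob_prod.
under eq_bigr => i _ do rewrite frob_frob -mulnS.
have := big_ord_recl N (fun i : 'I_N.+1 => frob (k * i) x) (op := *%R) (idx := 1).
rewrite big_ord_recr /= fx muln0 frob0 mulrC => /(mulfI nzx).
by rewrite /frob_norm => ->.
Qed.

Lemma frob_ker_tdiff k c N w : w \in lker (tdiff k c) ->
  frob (k * N) w = frob_norm k N c * w.
Proof.
rewrite mem_ker_tdiff => /eqP fw.
elim: N => [|N IHN]; first by rewrite muln0 frob0 /frob_norm big_ord0 mul1r.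
rewrite mulnSr -frob_frob fw frobM IHN /frob_norm big_ord_recr /= mulrA.
by congr (_ * _); rewrite mulrC.
Qed.

Lemma frob_eigen k c N w : frob k c = c -> frob k w = c * w ->
  frob (k * N) w = c ^+ N * w.
Proof.
move=> fc fw; elim: N => [|N IHN]; first by rewrite muln0 frob0 mul1r.
by rewrite mulnS -frob_frob IHN frobM frobX fc fw mulrA exprSr.
Qed.

(** q is a positive power of the characteristic of E. *)
Lemma natr_eq0_gcd_card N : N%:R = 0 :> E <-> gcdn N q <> 1%N.
Proof.
have [p pr_p pcharFp] := finPcharP F.
have pcharEp : p \in [pchar E] by rewrite pchar_lalg.
have qE : q = (p ^ logn p q)%N := card_pprimeChar pcharFp.
have k_gt0 : (0 < logn p q)%N.
  by rewrite lt0n; apply/eqP=> k0; have := card_field_gt1 F; rewrite qE k0.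
have coE : coprime N q = (N%:R != 0 :> E).
  rewrite qE coprime_pexpr // coprime_sym prime_coprime //.
  by rewrite (dvdn_pcharf pcharEp).
split=> [N0 /eqP | /eqP]; rewrite -/(coprime N q) coE; first by rewrite N0 eqxx.
by rewrite negbK => /eqP.
Qed.

Section Core.

Variables (r s : nat) (delta x : E).
Hypotheses (rn : (r %| n)%N) (sn : (s %| n)%N).
Hypothesis nzd : delta != 0.
Hypotheses (fd : frob r delta = delta) (fx : frob r x = x).
Let e := lcmn s r.
Let f := (n %/ e)%N.
Let M := (e %/ s)%N.
Let C := frob_norm s M x.

Let eE : e = (s * M)%N. Proof. by rewrite mulnC divnK ?dvdn_lcml. Qed.
Let eE' : e = (r * (e %/ r))%N. Proof. by rewrite mulnC divnK ?dvdn_lcmr. Qed.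
Let en : (e %| n)%N. Proof. by rewrite dvdn_lcm rn sn. Qed.
Let nE : n = (e * f)%N. Proof. by rewrite mulnC divnK. Qed.

Let fix_e y : frob r y = y -> frob e y = y.
Proof. by move=> fy; rewrite eE' frob_fix_mul. Qed.

Let fC : frob e C = C. Proof. exact/frob_norm_fix/fix_e. Qed.

Let frob_e w : w \in lker (tdiff s x) -> frob e w = C * w.
Proof. by move=> wK; rewrite eE (frob_ker_tdiff _ wK). Qed.

Let ker_quot w : w \in lker (tdiff s x) -> frob e (w / delta) = C * (w / delta).
Proof. by move=> wK; rewrite frobM frobV (fix_e fd) frob_e ?mulrA. Qed.

(* The compositum of [fixf r] and [fixf s] has dimension at least [e], so the
   trace from [E] to [fixf r] cannot vanish on a multiple of it unless the
   degree [f] is zero in [E]. *)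
Let trace_compositum kappa : kappa != 0 -> frob e kappa = kappa ->
  {in fixf s, forall t, kappa * t \in limg (tdiff r 1)} -> f%:R = 0 :> E.
Proof.
move=> nzk fk Hk; apply/eqP/negPn/negP => nzf.
have [r_gt0 _] := dvdn_dim_gt0 rn; have [e_gt0 _] := dvdn_dim_gt0 en.
pose K := (fixf r * fixf s)%AS.
have dimK : (e <= \dim K)%N.
  apply: dvdn_leq; first exact: adim_gt0.
  rewrite dvdn_lcm -{1}(dim_fixf sn) -(dim_fixf rn).
  by rewrite !field_dimS ?field_subvMl ?field_subvMr.
have nE' : (n %/ r)%N = (e %/ r * f)%N.
  by rewrite {1}nE eE' -mulnA mulKn // -eE'.
(* On fixed points of S^e the terms of the trace have period e / r, so each is counted f times. *)
have trE y : frob e y = y ->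
    frob_trace E r (n %/ r) y = f%:R * frob_trace E r (e %/ r) y.
  move=> fy; rewrite nE' !frob_traceE; elim: f => [|N IHN].
    by rewrite muln0 big_ord0 mul0r.
  rewrite mulnSr big_split_ord IHN /= -addn1 natrD mulrDl mul1r; congr (_ + _).
  apply: eq_bigr => i _; rewrite mulnDr addnC -frob_frob mulnA -eE'.
  by rewrite (frob_fix_mul _ fy).
(* As f is nonzero in E, the shorter trace with e / r terms vanishes on kappa K, which bounds its
   dimension by e - r < e. *)
have : (\dim (amull kappa @: K) <= r * (e %/ r).-1)%N.
  apply: dim_trace_zeros_le => //; first by rewrite divn_gt0 // dvdn_leq ?dvdn_lcmr.
  suff sub : (K <= fixf e :&: (amull kappa @^-1: limg (tdiff r 1)))%VS.
    move=> _ /memv_imgP[y Ky ->]; rewrite lfunE /=.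
    have := subvP sub y Ky; rewrite memv_cap mem_fixf -memv_preim => /andP[/eqP fy].
    rewrite lfunE /= limg_tdiff1 // memv_ker trE ?frobM ?fk ?fy //.
    by rewrite mulf_eq0 (negPf nzf) => /eqP.
  (* S^r - 1 is linear over [fixf r], so the hypothesis on [fixf s] extends to products y t. *)
  apply/prodvP=> y t; rewrite !mem_fixf => /eqP fy /eqP ft.
  rewrite memv_cap mem_fixf frobM (fix_e fy) eE (frob_fix_mul _ ft) eqxx /=.
  rewrite -memv_preim lfunE /= mulrCA.
  have /Hk/memv_imgP[z _ ->] : t \in fixf s by rewrite mem_fixf ft.
  apply/memv_imgP; exists (y * z); rewrite ?memvf // !tdiffE frobM fy.
  by rewrite mulrBr mulrCA.
rewrite dim_amull // => /(leq_trans dimK); rewrite {1}eE' leqNgt.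
by rewrite ltn_pmul2l // ltn_predL divn_gt0 // dvdn_leq ?dvdn_lcmr.
Qed.

Lemma norm_trace_criterion :
  (exists2 v, v != 0 & v \in lker (tdiff s x)) /\
  {in lker (tdiff s x), forall w, w / delta \in limg (tdiff r 1)} <->
  C ^+ f = 1 /\ (C <> 1 \/ f%:R = 0 :> E).
Proof.
split=> [[[v nzv vK] Hw] | [Cf HC]].
  split.
    (* S^n v = v, while iterating S^e v = C v gives S^n v = C^f v. *)
    apply: (mulIf nzv); rewrite mul1r -[RHS]frob_dim nE.
    by rewrite (frob_eigen _ fC (frob_e vK)).
  have [C1|/eqP] := eqVneq C 1; [right | by left].
  apply: (@trace_compositum (v / delta)).
  - by rewrite mulf_neq0 ?invr_eq0.
  - by rewrite ker_quot // C1 mul1r.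
  move=> t ft; rewrite mulrAC; apply: Hw; rewrite (ker_tdiff_coset nzv vK).
  by apply/memv_imgP; exists t; rewrite // lfunE.
split.
  have [||v nzv fv] := @Hilbert90_finite F E s x; first by [].
    rewrite -frob_normE {1}nE eE -mulnA mulKn; last by case: (dvdn_dim_gt0 sn).
    by rewrite frob_normM // -eE fix_e.
  by exists v; rewrite // mem_ker_tdiff fv.
(* Since r divides e, it suffices to reach the image of S^e - 1. *)
move=> w wK; apply: (subvP (limg_tdiff1_mul E r (e %/ r))); rewrite -eE'.
have [C1 | nzC] := eqVneq C 1; last first.
  have nzC1 : C - 1 != 0 by rewrite subr_eq0.
  (* S^e multiplies w / delta by C and fixes C - 1. *)
  apply/memv_imgP; exists (w / delta / (C - 1)); rewrite ?memvf //.
  rewrite tdiffE frobM ker_quot // frobV; have -> : frob e (C - 1) = C - 1.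
    by rewrite rmorphB /= fC rmorph1.
  by rewrite mul1r -mulrBl -[X in (_ - X)]mul1r -mulrBl [RHS]mulrC mulKf.
case: HC => [/(_ C1) // | f0].
(* Now S^e fixes w / delta, so its trace to F_(q^e) is f times itself. *)
rewrite limg_tdiff1 // memv_ker frob_traceE -/f.
under eq_bigr => i _ do rewrite (frob_eigen _ fC (ker_quot wK)) C1 expr1n mul1r.
by rewrite sumr_const card_ord -mulr_natl f0 mul0r.
Qed.

End Core.

End NormTrace.

(** * Evaluation of C, and its translation into conditions (i) and (ii) *)

Section NormEvaluation.

Set Implicit Arguments.
Unset Strict Implicit.
Unset Printing Implicit Defensive.

Variables (F : finFieldType) (E : fieldExtType F).
Local Notation q := #|F|.
Local Notation frob := (frob E).
Implicit Types (x y c u v w delta : E) (i j k r s : nat).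

Lemma mulmod_inj (S M : nat) (M_gt0 : (0 < M)%N) : coprime S M ->
  injective (fun i : 'I_M => Ordinal (ltn_pmod (S * i) M_gt0)).
Proof.
move=> co i j [] /eqP eq_ij; apply: val_inj => /=.
wlog le_ij : i j eq_ij / (i <= j)%N.
  move=> IH; case: (leqP i j) => [/(IH _ _ eq_ij) // | /ltnW le_ji].
  by apply/esym/IH; rewrite // eq_sym.
move: eq_ij; rewrite eq_sym eqn_mod_dvd ?leq_mul2l ?le_ij ?orbT // -mulnBr.
rewrite Gauss_dvdr 1?coprime_sym // => /dvdnP[[|t] ijE].
  by apply/eqP; rewrite eqn_leq le_ij /= -subn_eq0 ijE.
have := leq_subr i j; rewrite ijE mulSn => /(leq_trans (leq_addr _ _)).
by rewrite leqNgt ltn_ord.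
Qed.

Lemma lcmn_divl r s : (0 < s)%N -> (lcmn s r %/ s = r %/ gcdn s r)%N.
Proof. by move=> s_gt0; rewrite /lcmn -muln_divA ?dvdn_gcdr // mulKn. Qed.

(* On [fixf r], the norm from [fixf (lcm s r)] to [fixf s] is the norm to
   [fixf (gcd s r)]. *)
Lemma frob_norm_gcd r s delta : (0 < r)%N -> (0 < s)%N ->
  frob r delta = delta ->
  frob_norm s (lcmn s r %/ s) delta
  = frob_norm (gcdn s r) (r %/ gcdn s r) delta.
Proof.
move=> r_gt0 s_gt0 fd; rewrite lcmn_divl //.
have g_gt0 : (0 < gcdn s r)%N by rewrite gcdn_gt0 s_gt0.
set g := gcdn s r in g_gt0 *; set M := (r %/ g)%N.
have rE : r = (g * M)%N by rewrite mulnC divnK ?dvdn_gcdr.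
have sE : s = (g * (s %/ g))%N by rewrite mulnC divnK ?dvdn_gcdl.
have M_gt0 : (0 < M)%N by move: r_gt0; rewrite {1}rE muln_gt0 => /andP[].
have co : coprime (s %/ g) M.
  by rewrite /coprime -(eqn_pmul2l g_gt0) muln_gcdr -sE -rE muln1.
(* On delta, Frobenius exponents matter only modulo r = g M, and s i mod r is g times the residue of
   (s / g) i modulo M. *)
rewrite /frob_norm [RHS](reindex_inj (mulmod_inj (M_gt0 := M_gt0) co)).
apply: eq_bigr => i _ /=; rewrite muln_modr -rE (frob_fix_mod _ fd).
by rewrite mulnA -sE.
Qed.

Section Values.

Variables (m l : nat) (delta : E).
Hypotheses (l_gt0 : (0 < l)%N) (lm : (l < m)%N).
Hypotheses (nzd : delta != 0) (fd : frob (m - l) delta = delta).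
Let r := (m - l)%N.
Let s := (m + l)%N.
Let e := lcmn s r.
Let C := frob_norm s (e %/ s) (frob m delta / delta).
Let nu := frob_norm (gcdn s r) (r %/ gcdn s r) delta.

Let r_gt0 : (0 < r)%N. Proof. by rewrite subn_gt0. Qed.
Let s_gt0 : (0 < s)%N. Proof. by rewrite addn_gt0 l_gt0 orbT. Qed.
Let lm2 : (0 < l < m)%N. Proof. by rewrite l_gt0. Qed.

(** The norm is multiplicative and commutes with S^m. *)
Let CE : C = frob m nu / nu.
Proof.
rewrite /C /nu -frob_norm_gcd //.
rewrite [in RHS]frob_prod /frob_norm -prodfV -big_split /=.
apply: eq_bigr => i _; rewrite frobM frobV !frob_frob.
by rewrite addnC.
Qed.

Let nz_nu : nu != 0.
Proof. by apply/prodf_neq0 => i _; rewrite frob_eq0. Qed.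

Let nu_fix : frob (gcdn s r) nu = nu.
Proof. by apply: frob_norm_shift => //; rewrite mulnC divnK ?dvdn_gcdr. Qed.

Lemma norm_value_one : (logn 2 (m - l) <= logn 2 l)%N -> C = 1.
Proof.
move=> v2; have /dvdnP[k mE] := gcdn_sum_diff_dvd lm2 v2.
by rewrite CE mE mulnC frob_fix_mul // divff.
Qed.

(** S^(2d) fixes nu and m is an odd multiple of d, so S^m nu = S^d nu and C = nu^(q^d - 1). As
    q^(2d) - 1 = (q^d - 1)(q^d + 1), the resulting exponent of delta is (q^r - 1) / (q^d + 1). *)
Lemma norm_value_pow : (logn 2 l < logn 2 (m - l))%N ->
  let d := gcdn m (m - l) in
  C = delta ^+ ((q ^ (m - l) - 1) %/ (q ^ d + 1))%N /\ C ^+ (q ^ d + 1)%N = 1.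
Proof.
move=> v2 d; have [gE [k mE]] := gcdn_sum_diff_double lm2 v2.
have q_gt1 := card_field_gt1 F.
have qd_gt0 : (0 < q ^ d)%N by rewrite expn_gt0 ltnW.
have rE : (m - l = 2 * d * (r %/ gcdn s r))%N.
  by rewrite -gE mulnC divnK ?dvdn_gcdr.
have qrE : (q ^ (m - l) - 1 = (q ^ d - 1) *
    (\sum_(i < r %/ gcdn s r) (q ^ gcdn s r) ^ i) * (q ^ d + 1))%N.
  rewrite {1}rE expnM !subn1 predn_exp gE mul2n -addnn expnD mulnAC; congr (_ * _)%N.
  by case: (q ^ d)%N qd_gt0 => // t _; rewrite addn1 mulSn addSn /= -mulnS.
have CE' : C = delta ^+ ((q ^ (m - l) - 1) %/ (q ^ d + 1))%N.
  rewrite CE; have -> : frob m nu = frob d nu.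
    rewrite {1}mE -/d mulnS -frob_frob mulnCA mulnA -gE.
    by rewrite (frob_fix_mul _ nu_fix).
  rewrite qrE mulnK ?addn1 // mulnC exprM -frob_normE -/nu frobE.
  by apply: (mulIf nz_nu); rewrite divfK // -exprSr subn1 prednK.
split=> //; rewrite CE' -exprM divnK; last by rewrite qrE dvdn_mull.
apply: (mulIf nzd); rewrite mul1r -exprSr subn1 prednK ?expn_gt0 ?(ltnW q_gt1) //.
by rewrite -frobE.
Qed.

End Values.

(** In case (i) C = 1, which leaves f = 0 in E. In case (ii) C^(q^d + 1) = 1, so C^f = 1 amounts to
    C^gcd(f, q^d + 1) = 1. *)
Lemma norm_criterion_cond n m l delta : (0 < l)%N -> (l < m)%N ->
  delta != 0 -> frob (m - l) delta = delta ->
  let e := lcmn (m + l) (m - l) in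
  let C := frob_norm (m + l) (e %/ (m + l)) (frob m delta / delta) in
  C ^+ (n %/ e)%N = 1 /\ (C <> 1 \/ (n %/ e)%:R = 0 :> E) <->
  cond_i q n m l \/ cond_ii q n m l delta.
Proof.
move=> l_gt0 lm nzd fd e C; rewrite /cond_i /cond_ii -/e.
set f := (n %/ e)%N; have f0 := natr_eq0_gcd_card E f.
case: (leqP (logn 2 (m - l)) (logn 2 l)) => v2.
  have C1 : C = 1 by apply: norm_value_one.
  rewrite C1 expr1n; split=> [[_ [//|/f0 ?]] | [[_ /f0 ?] | []//]]; first by left.
  by split=> //; right.
have [CE Cd] := norm_value_pow l_gt0 lm nzd fd v2; rewrite -/C in CE Cd.
split=> [[Cf HC] | [[//]|[_]]].
  right; split=> //; first by rewrite exprM -CE expr_gcdn1.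
  by rewrite -CE; case: HC => [|/f0]; [left | right].
rewrite exprM -CE => Cg HC; split; last by case: HC => [|/f0]; [left|right].
have /dvdnP[t ->] := dvdn_gcdl f (q ^ gcdn m (m - l) + 1).
by rewrite mulnC exprM Cg expr1n.
Qed.

End NormEvaluation.

(** * The binomial, its adjoint and the kernel of L *)

Section Binomial.

Set Implicit Arguments.
Unset Strict Implicit.
Unset Printing Implicit Defensive.

Variables (F : finFieldType) (E : fieldExtType F) (m l : nat) (a b : E).
Local Notation q := #|F|.
Local Notation n := (\dim {:E}).
Local Notation frob := (frob E).
Hypotheses (l_gt0 : (0 < l)%N) (lm : (l < m)%N) (mn : (2 * m < n)%N).
Local Notation r := (m - l)%N.
Local Notation s := (m + l)%N.
Local Notation ell := (qbinomial q m l a b).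

Let q_gt1 : (1 < q)%N. Proof. exact: card_field_gt1. Qed.
Let m_gt0 : (0 < m)%N. Proof. exact: ltn_trans lm. Qed.
Let m_lt_n : (m < n)%N.
Proof. by apply: leq_ltn_trans mn; rewrite leq_pmull. Qed.
Let l_lt_n : (l < n)%N. Proof. exact: ltn_trans m_lt_n. Qed.
Let s_lt_n : (s < n)%N.
Proof. by apply: leq_ltn_trans mn; rewrite mul2n -addnn leq_add2l ltnW. Qed.
Let r_gt0 : (0 < r)%N. Proof. by rewrite subn_gt0. Qed.
Let s_gt0 : (0 < s)%N. Proof. by rewrite addn_gt0 l_gt0 orbT. Qed.

Lemma coef_qbinomial i :
  ell`_(q ^ i) = a *+ (i == m) + b *+ (i == l).
Proof.
rewrite coefD !coefZ !coefXn !mulr_natr.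
by rewrite !(inj_eq (expnI q_gt1)).
Qed.

Lemma qadjoint_qbinomial :
  qadjoint q n ell = frob (n - m) a *: 'X^(q ^ (n - m)) +
                     frob (n - l) b *: 'X^(q ^ (n - l)).
Proof.
have := coef_qbinomial 0; rewrite expn0 [0%N == m]ltn_eqF // [0%N == l]ltn_eqF //.
rewrite !mulr0n addr0 /qadjoint => ->; rewrite scale0r add0r.
rewrite (bigD1_seq m) ?mem_index_iota ?iota_uniq ?m_gt0 //=.
rewrite -big_filter (bigD1_seq l) ?filter_uniq ?iota_uniq //=; last first.
  by rewrite mem_filter mem_index_iota l_gt0 l_lt_n neq_ltn lm.
rewrite big_filter_cond /= big1 => [|i /andP[im il]].
  rewrite addr0 !coef_qbinomial !eqxx [m == l]gtn_eqF // [l == m]ltn_eqF //.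
  by rewrite !mulr0n !mulr1n addr0 add0r !exprZn !frobE.
(* The other summands are 0 raised to the positive power q^(n-i). *)
rewrite coef_qbinomial (negPf im) (negPf il) !mulr0n addr0 scale0r expr0n.
by rewrite expn_eq0 eqn0Ngt ltnW.
Qed.

Lemma qbinomial_frob k :
  ell ^+ (q ^ k) = frob k a *: 'X^(q ^ (m + k)) + frob k b *: 'X^(q ^ (l + k)).
Proof.
have [p pr_p pcharFp] := finPcharP F.
have pcharEp : p \in [pchar {poly E}] by rewrite pchar_lalg pchar_lalg.
rewrite exprDn_pchar; last first.
  by rewrite pnatX (card_pprimeChar pcharFp) pnatX pnatE // pcharEp.
by rewrite !exprZn -!exprM -!expnD !frobE.
Qed.

(** Both sides involve the exponents q^(n-l) and q^(n-m) only. Comparing coefficients and applying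
    S^s, the inverse of S^(n-m-l), gives a S^s(alpha) = S^m b and b S^s(alpha) = S^l a; alpha is
    then eliminated. *)
Lemma adjoint_proportional : a != 0 -> b != 0 ->
  (exists2 alpha : E, alpha != 0
     & alpha *: ell ^+ (q ^ (n - m - l)) = qadjoint q n ell)
  <-> frob l a * a = frob m b * b.
Proof.
move=> nza nzb; rewrite qbinomial_frob qadjoint_qbinomial.
have nlE : (m + (n - m - l) = n - l)%N.
  by rewrite addnBA ?subnKC // ?(ltnW m_lt_n) // leq_subRL ?(ltnW m_lt_n) // ltnW.
have nmE : (l + (n - m - l) = n - m)%N.
  by rewrite subnKC // leq_subRL ?(ltnW m_lt_n) // ltnW.
rewrite nlE nmE.
have neq : (q ^ (n - l) == q ^ (n - m))%N = false.
  rewrite (inj_eq (expnI q_gt1)); apply/negbTE; rewrite neq_ltn.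
  by rewrite [X in _ || X]ltn_sub2l ?orbT.
have neq' : (q ^ (n - m) == q ^ (n - l))%N = false by rewrite eq_sym.
split=> [[alpha nzal polyE] | abE].
  have eb : alpha * frob (n - m - l) a = frob (n - l) b.
    have := congr1 (fun p : {poly E} => p`_(q ^ (n - l))) polyE.
    by rewrite coefZ !coefD !coefZ !coefXn eqxx neq !mulr0 !mulr1 addr0 add0r.
  have ea : alpha * frob (n - m - l) b = frob (n - m) a.
    have := congr1 (fun p : {poly E} => p`_(q ^ (n - m))) polyE.
    by rewrite coefZ !coefD !coefZ !coefXn eqxx neq' !mulr0 !mulr1 addr0 add0r.
  have sE : (s + (n - m - l) = n)%N by rewrite -subnDA subnKC // ltnW.
  have := congr1 (frob s) ea; have := congr1 (frob s) eb.
  rewrite !frobM !frob_frob sE !frob_dim.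
  have -> : (s + (n - l) = n + m)%N by rewrite -addnA subnKC 1?addnC // ltnW.
  have -> : (s + (n - m) = n + l)%N by rewrite addnAC subnKC // ltnW.
  by rewrite !frob_addn => <- <-; rewrite mulrAC.
(* This solves S^s(alpha) = S^m b / a. *)
exists (frob (n - m - l) (frob m b / a)).
  by rewrite frob_eq0 mulf_neq0 ?invr_eq0 ?frob_eq0.
rewrite scalerDr !scalerA -!frobM divfK // mulrAC -abE mulfK // !frob_frob.
by rewrite ![(n - m - l + _)%N]addnC nlE nmE addrC.
Qed.

Section Kernel.

Hypotheses (q_odd : odd q) (nza : a != 0).
Hypothesis abE : frob l a * a = frob m b * b.
Local Notation L := (poly_end (qsympart q n ell)).
Local Notation c1 := (- (b / a)).
Local Notation c2 := (- (frob m b / a)).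

Lemma two_neq0 : 2%:R != 0 :> E.
Proof.
apply/eqP=> /natr_eq0_gcd_card; apply; apply/eqP.
by rewrite -/(coprime 2 q) coprime2n.
Qed.

(** S^s turns the adjoint into S^m b S^m x + S^l a S^l x, which by [abE] is (S^m b / a) ell(x).
    Hence S^s(2 L x) = (S^s - c2) ell(x), where ell(x) = a (S^r - c1) S^l x. *)
Lemma ker_sympart x : (x \in lker L) =
  (frob l x \in lker (tdiff s c2 \o (amull a \o tdiff r c1))).
Proof.
rewrite !memv_ker qsympart_endE /qsympart hornerZ mulf_eq0 invr_eq0.
rewrite (negPf two_neq0) /= -(frob_eq0 s) qadjoint_qbinomial.
rewrite /qbinomial !hornerE !comp_lfunE !tdiffE !amullE.
rewrite frob_frob subnK ?(ltnW lm) //.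
have -> : a * (frob m x - c1 * frob l x) = a * frob m x + b * frob l x by field.
rewrite -!frobE !rmorphD /= !frobM !frob_frob.
have -> : (s + (n - l) = n + m)%N by rewrite -addnA subnKC 1?addnC // ltnW.
have -> : (s + (n - m) = n + l)%N by rewrite addnAC subnKC // ltnW.
have aE : frob l a = frob m b * b / a by rewrite -abE mulfK.
rewrite !frob_addn aE; congr (_ == 0).
by field.
Qed.

(** S^l is bijective, so ker L has the dimension of the composite kernel, whose bound is r + s =
    2m. *)
Lemma dim_ker_sympart : \dim (lker L) = (2 * m)%N <->
  [/\ \dim (lker (tdiff r c1)) = r, \dim (lker (tdiff s c2)) = s
    & (lker (tdiff s c2) <= limg (amull a \o tdiff r c1))%VS].
Proof.
have -> : (2 * m = r + s)%N by rewrite addnCA addnC subnK ?(ltnW lm) // mul2n addnn.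
have kerh : lker (amull a \o tdiff r c1) = lker (tdiff r c1).
  apply/vspaceP=> x; rewrite !memv_ker comp_lfunE amullE mulf_eq0.
  by rewrite (negPf nza).
have imgL : (frob l @: lker L)%VS = lker (tdiff s c2 \o (amull a \o tdiff r c1)).
  apply/vspaceP=> y; apply/memv_imgP/idP => [[x xL ->] | yK].
    by rewrite -ker_sympart.
  exists (frob (n - l) y); rewrite ?ker_sympart frob_frob subnKC ?frob_dim //.
    exact: ltnW.
  exact: ltnW.
rewrite -(@limg_dim_eq _ _ _ (frob l)) ?lker_frob ?capv0 // imgL.
rewrite dim_lker_comp_max ?kerh //; exact: dim_ker_tdiff_le.
Qed.

End Kernel.

Section SpecialForm.

Variables gamma delta : E.
Hypotheses (q_odd : odd q) (nzg : gamma != 0) (nzd : delta != 0).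
Hypothesis fd : frob r delta = delta.
Hypothesis aE : a = frob m gamma * gamma * delta.
Hypothesis bE : b = - (frob l gamma * gamma * delta).
Hypotheses (rn : (r %| n)%N) (sn : (s %| n)%N).
Local Notation L := (poly_end (qsympart q n ell)).
Local Notation x := (frob m delta / delta).

Let frob_r_l y : frob r (frob l y) = frob m y.
Proof. by rewrite frob_frob subnK // ltnW. Qed.

Let fd_ml : frob m delta = frob l delta.
Proof. by rewrite -frob_r_l frob_frob addnC -frob_frob fd. Qed.

Lemma special_norm_eq : frob l a * a = frob m b * b.
Proof.
rewrite aE bE rmorphN /= !frobM !frob_frob fd_ml [(l + m)%N]addnC.
by ring.
Qed.

Let nza : a != 0.
Proof. by rewrite aE !mulf_neq0 ?frob_eq0. Qed.

(** The kernel of S^r - c1 is full, as it contains the inverse of S^l gamma. Replacing v by gamma v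
    turns S^s - c2 into S^s - x, and a (S^r - c1) y = gamma delta (S^r - 1)(y S^l gamma) turns the
    image condition into one on v / delta. *)
Lemma special_criterion :
  let e := lcmn s r in let f := (n %/ e)%N in
  let C := frob_norm s (e %/ s) x in
  \dim (lker L) = (2 * m)%N <-> C ^+ f = 1 /\ (C <> 1 \/ f%:R = 0 :> E).
Proof.
move=> e f C; rewrite dim_ker_sympart //; last exact: special_norm_eq.
have fx : frob r x = x.
  by rewrite frobM frobV fd frob_frob addnC -frob_frob fd.
rewrite /C /f -(@norm_trace_criterion F E r s delta) //.
have nzgm : frob m gamma != 0 by rewrite frob_eq0.
have nzgl : frob l gamma != 0 by rewrite frob_eq0.
have nzgs : frob s gamma != 0 by rewrite frob_eq0.
set c1 := - (b / a); set c2 := - (frob m b / a).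
have c1E : c1 = frob l gamma / frob m gamma.
  by rewrite /c1 aE bE; field; rewrite nzgm nzg nzd.
have c2E : c2 = frob s gamma / gamma * x.
  rewrite /c2 aE bE rmorphN /= !frobM frob_frob; field.
  by rewrite nzgm nzg nzd.
have ker1 : \dim (lker (tdiff r c1)) = r.
  apply/dim_ker_tdiff => //; split=> //; exists (frob l gamma)^-1.
    by rewrite invr_eq0.
  by rewrite mem_ker_tdiff frobV frob_r_l c1E mulrAC divff // mul1r.
have mem2 v : (gamma * v \in lker (tdiff s c2)) = (v \in lker (tdiff s x)).
  rewrite !mem_ker_tdiff frobM c2E.
  have -> : frob s gamma / gamma * x * (gamma * v) = frob s gamma * (x * v).
    by field; rewrite nzg nzd.
  by rewrite (inj_eq (mulfI nzgs)).
have img1 v : (gamma * v \in limg (amull a \o tdiff r c1)) =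
              (v / delta \in limg (tdiff r 1)).
  have key y : amull a (tdiff r c1 y) =
      gamma * delta * tdiff r 1 (y * frob l gamma).
    rewrite amullE !tdiffE frobM frob_r_l c1E aE; field.
    by rewrite nzgm.
  apply/memv_imgP/memv_imgP => [[y _] | [y _ vE]].
    rewrite comp_lfunE key -mulrA => /(mulfI nzg) ->.
    by exists (y * frob l gamma); rewrite ?memvf // mulrC mulKf.
  exists (y / frob l gamma); rewrite ?memvf // comp_lfunE key divfK // -vE.
  by field.
have gK (w : E) : gamma * (w / gamma) = w by rewrite mulrC divfK.
split=> [[_ ker2 /subvP sub] | [[v nzv vK] Hw]].
  have /dim_ker_tdiff [//|_ [u nzu uK]] := ker2.
  split; last by move=> w wK; rewrite -img1; apply: sub; rewrite mem2.
  by exists (u / gamma); rewrite ?mulf_neq0 ?invr_eq0 // -mem2 gK.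
split=> //.
  apply/dim_ker_tdiff => //; split=> //; exists (gamma * v); rewrite ?mem2 //.
  by rewrite mulf_neq0.
by apply/subvP=> w; rewrite -[w]gK mem2 img1; apply: Hw.
Qed.

End SpecialForm.

(** A nonzero kernel element u determines gamma by S^l gamma = 1 / u, and a then determines delta;
    the equation S^r u = -(b / a) u gives the form of b. *)
Lemma special_form_exists : a != 0 -> frob l a * a = frob m b * b ->
  \dim (lker (tdiff r (- (b / a)))) = r ->
  exists gamma delta : E, [/\ gamma != 0, delta != 0, frob r delta = delta,
    a = frob m gamma * gamma * delta & b = - (frob l gamma * gamma * delta)].
Proof.
move=> nza abE /dim_ker_tdiff[//|_ [u nzu]].
rewrite mem_ker_tdiff => /eqP fu.
have [gamma gl] : exists y, frob l y = u^-1.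
  by exists (frob (n - l) u^-1); rewrite frob_frob subnKC ?frob_dim // ltnW.
have gm : frob m gamma = (frob r u)^-1.
  by rewrite -frobV -gl frob_frob subnK // ltnW.
have nzg : gamma != 0 by rewrite -(frob_eq0 l) gl invr_eq0.
have nzru : frob r u != 0 by rewrite frob_eq0.
have nzgm : frob m gamma != 0 by rewrite frob_eq0.
have nzgs : frob s gamma != 0 by rewrite frob_eq0.
have nzgl : frob l gamma != 0 by rewrite frob_eq0.
have [delta aE] : exists y, a = frob m gamma * gamma * y.
  exists (a / (frob m gamma * gamma)).
  by rewrite mulrC divfK // mulf_neq0.
have nzd : delta != 0 by apply: contraNneq nza => d0; rewrite aE d0 mulr0.
have bE : b = - (frob l gamma * gamma * delta).
  have -> : b = - (- (b / a) * u * a / u) by field; rewrite nzu nza.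
  rewrite -fu aE gl gm; field.
  by rewrite nzu nzru.
exists gamma, delta; split=> //.
(* It remains to see that S^m delta = S^l delta; the two sides of [abE] are these elements times the
   same nonzero factor t. *)
apply: (fmorph_inj (frob l)); rewrite /= frob_frob subnKC ?(ltnW lm) //.
move: abE; rewrite aE bE rmorphN /= !frobM !frob_frob [(l + m)%N]addnC => abE.
pose t := frob s gamma * frob l gamma * frob m gamma * gamma * delta.
have nzt : t != 0 by rewrite !mulf_neq0.
apply: (mulfI nzt); transitivity
  (- (frob s gamma * frob m gamma * frob m delta)
   * - (frob l gamma * gamma * delta)).
  by rewrite /t; ring.
by rewrite -abE /t; ring.
Qed.

End Binomial.

Theorem theorem4p5 (F : finFieldType) (E : fieldExtType F) (q n m l : nat)
    (a b : E) (hq : #|F| = q) (q_odd : odd q)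
    (hn : \dim {:E} = n) (n_gt1 : (1 < n)%N)
    (a_neq0 : a != 0) (b_neq0 : b != 0)
    (l_gt0 : (0 < l)%N) (l_lt_m : (l < m)%N) (m_lt_half : (2 * m < n)%N) :
  let ell : {poly E} := qbinomial q m l a b in
  let L : 'End(E) := poly_end (qsympart q n ell) in
  let special_form : Prop :=
    [/\ (m + l %| n)%N, (m - l %| n)%N
      & exists gamma delta : E,
        [/\ gamma != 0,
            delta != 0 /\ in_GF (m - l) delta,
            a = gamma ^+ (q ^ m + 1)%N * delta,
            b = - (gamma ^+ (q ^ l + 1)%N * delta)
          & cond_i q n m l \/ cond_ii q n m l delta]] in
  [/\ (exists2 alpha : E, alpha != 0
         & alpha *: ell ^+ (q ^ (n - m - l))%N = qadjoint q n ell)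
      <-> a ^+ (q ^ l + 1)%N = b ^+ (q ^ m + 1)%N,
      special_form -> \dim (lker L) = (2 * m)%N
    & a ^+ (q ^ l + 1)%N = b ^+ (q ^ m + 1)%N ->
      \dim (lker L) = (2 * m)%N -> special_form].
Proof.
subst q n.
have powE k (y : E) : y ^+ (#|F| ^ k + 1) = frob E k y * y.
  by rewrite exprD expr1 frobE.
move=> ell L special_form; rewrite /special_form !powE; split.
- exact: adjoint_proportional.
- case=> sn rn [gamma [delta [nzg [nzd /in_GFE-/(_ rn) fd]]]].
  rewrite !powE => aE bE; rewrite -norm_criterion_cond // => crit.
  by apply/(special_criterion _ _ _ _ nzg nzd fd aE bE).
move=> abE dimL.
(* Both factors have full kernels, which yields the two divisibilities, and the first kernel
   supplies gamma and delta. *)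
have [dim_r dim_s _] :=
  proj1 (dim_ker_sympart l_gt0 l_lt_m m_lt_half q_odd a_neq0 abE) dimL.
have r_gt0 : (0 < m - l)%N by rewrite subn_gt0.
have s_gt0 : (0 < m + l)%N by rewrite addn_gt0 l_gt0 orbT.
have [rn _] := proj1 (dim_ker_tdiff _ r_gt0) dim_r.
have [sn _] := proj1 (dim_ker_tdiff _ s_gt0) dim_s.
have [gamma [delta [nzg nzd fd aE bE]]] :=
  special_form_exists l_lt_m m_lt_half a_neq0 abE dim_r.
split=> //; exists gamma, delta; rewrite !powE; split=> //.
  by split=> //; apply/in_GFE.
rewrite -norm_criterion_cond //.
by apply/(special_criterion _ _ _ _ nzg nzd fd aE bE).
Qed.
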